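(* Let $(X,\mathcal{B},T)$ be a Borel system and $A\in\mathcal{B}$. Let $\mathrm{null}(A)$ be the ($T$-invariant, measurable) set of points $x\in\bigcup_{n\in\mathbb{Z}}T^nA$ such that $\lim_{n\to\infty}\frac1n\sum_{i=0}^{n-1}1_A(T^ix)=0$. Then the restriction of $T$ to $\mathrm{null}(A)$ has a $4$-set generator.
   Context: A Borel system $(X,\mathcal{B},T)$ is a standard Borel space with a Borel automorphism $T$. For an invariant Borel set $Y\subseteq X$, a $k$-set generator of $T|_Y$ is a measurable partition $\{B_1,\dots,B_k\}$ of $Y$ (empty members allowed) such that $\{T^jB_i: j\in\mathbb{Z},1\le i\le k\}$ generates the $\sigma$-algebra $\mathcal{B}|_Y$ of Borel subsets of $Y$. *)

(* Defs.v *)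
From HB Require Import structures.
From mathcomp Require Import all_boot all_order all_algebra.
From mathcomp Require Import all_classical all_reals all_analysis.

Set Implicit Arguments.
Unset Strict Implicit.
Unset Printing Implicit Defensive.

Import Order.TTheory GRing.Theory Num.Theory.
Import numFieldNormedType.Exports.

Local Open Scope classical_set_scope.
Local Open Scope ring_scope.

(* Measurable spaces are given here as a bare carrier [X : Type] with a family
   [B : set (set X)], because [measurableType] is pointed and would exclude the
   empty Borel system. *)

(* The library's [completeType] is pointed as well, so its completeness axiom
   is restated for [metricType]. *)
Definition polish (R : realType) (Y : metricType R) : Prop :=
  (forall F : set_system Y, ProperFilter F -> cauchy F ->
     exists y : Y, F --> y) /\
  (exists2 D : set Y, countable D & dense D).

Definition standard_borel (R : realType) (X : Type) (B : set (set X)) : Prop :=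
  exists (Y : metricType R) (f : Y -> X),
    [/\ polish Y, bijective f &
        forall C : set X, B C <-> <<s @open Y >> (f @^-1` C)].

Definition borel_automorphism (X : Type) (B : set (set X)) (T : X -> X) : Prop :=
  [/\ bijective T,
      forall C, B C -> B (T @^-1` C) &
      forall C, B C -> B (T @` C)].

(* T^n C for n : int; for a bijection T, the image of C under T^-k is the
   preimage of C under T^k, so no explicit inverse of T is needed. *)
Definition translate (X : Type) (T : X -> X) (n : int) (C : set X) : set X :=
  match n with
  | Posz k => iter k T @` C
  | Negz k => iter k.+1 T @^-1` C
  end.

(* The term n = 0 of the sequence of averages is 0 / 0 = 0, which is
   irrelevant to the limit. *)
Definition null_part (R : realType) (X : Type) (T : X -> X) (A : set X) : set X :=
  [set x | (\bigcup_(n in [set: int]) translate T n A) x /\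
    (fun n : nat => n%:R^-1 * \sum_(0 <= i < n) (\1_A (iter i T x) : R))
      @ \oo --> (0 : R)].

(* Equality of the two families forces Y to be Borel and T-invariant. *)
Definition is_set_generator (X : Type) (B : set (set X)) (T : X -> X)
    (Y : set X) (k : nat) (P : 'I_k -> set X) : Prop :=
  [/\ forall i, B (P i),
      trivIset [set: 'I_k] P,
      \bigcup_(i in [set: 'I_k]) P i = Y &
      <<s Y, [set C | exists (j : int) (i : 'I_k), C = translate T j (P i)] >>
        = [set C | B C /\ C `<=` Y]].

Definition has_set_generator (X : Type) (B : set (set X)) (T : X -> X)
    (Y : set X) (k : nat) : Prop :=
  exists P : 'I_k -> set X, is_set_generator B T Y P.

(* Main.v *)
(* Write [visits A x n] for the number of visits to [A] among x, ..., T^(n-1) x.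

   Let R_w be the set of points x such that [w * visits A x n < n] for all
   [n > 0].  Since [A] has forward density 0 on null(A), every forward orbit
   meets R_w: take the last time at which [n <= w * visits A x n].  If every
   orbit also meets R_w in the past, R_w cuts each orbit into finite blocks in
   which fewer than one point out of w lies in [A]; the blocks grow with w since
   the R_w decrease.  Level k then stores one bit for each point a of [A] at a
   point outside [A] of the R_(k+2)-block of a, the n-th point of [A] in the
   block using the n-th point of the block left free by the previous levels.
   Previous levels have occupied at most [k * #A] points of a block, so there is
   enough room.  The storage place of bit k of a is determined by the itinerary
   of [A] alone, so if [E] is the set of storage places holding a 1, then [A],
   [E] and the remaining points of null(A) determine infinitely many bits of every
   point of [A], hence everything; the fourth set is empty.

   On an orbit which has a first point of R_w for some w, that point is a Borel
   selector for the orbit.  There [A] is replaced by the selector, which is met at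
   most once, so that the new R_w are met in the past as well. *)

Require Import Defs.
From HB Require Import structures.
From mathcomp Require Import all_boot all_order all_algebra.
From mathcomp Require Import all_classical all_reals all_analysis.
From mathcomp Require Import zify.

Set Implicit Arguments.
Unset Strict Implicit.
Unset Printing Implicit Defensive.

Import Order.TTheory GRing.Theory Num.Theory.
Import numFieldNormedType.Exports.

Local Open Scope classical_set_scope.

(** * Counting visits *)

Lemma leq_count_injective_rel (r : nat) (p q : pred nat) (L : nat -> nat -> Prop) :
  (forall i, i < r -> p i -> exists j, [/\ j < r, q j & L i j]) ->
  (forall i i' j, i < r -> i' < r -> L i j -> L i' j -> i = i') ->
  count p (iota 0 r) <= count q (iota 0 r).
Proof.
move=> total inj.
have [f fP] : exists f : nat -> nat, forall i, i < r -> p i ->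
    [/\ f i < r, q (f i) & L i (f i)].
  have /choice[f fP] : forall i, exists j, i < r -> p i -> [/\ j < r, q j & L i j].
    move=> i; have [/andP[ir pi]|] := boolP ((i < r) && p i).
      by have [j ?] := total _ ir pi; exists j.
    by move=> nip; exists 0 => ir pi; move: nip; rewrite ir pi.
  by exists f.
rewrite -!size_filter -(size_map f).
apply: uniq_leq_size.
  rewrite map_inj_in_uniq ?filter_uniq ?iota_uniq// => i i'.
  rewrite !mem_filter !mem_iota !add0n /= => /andP[pi ir] /andP[pi' ir'] eqf.
  have [_ _ Li] := fP _ ir pi; have [_ _ Li'] := fP _ ir' pi'.
  by apply: (inj i i' (f i)) => //; rewrite eqf.
move=> _ /mapP[i + ->]; rewrite !mem_filter !mem_iota !add0n /= => /andP[pi ir].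
by have [-> ->] := fP _ ir pi.
Qed.

Section Visits.
Variables (X : Type) (T : X -> X).

Definition visits (F : set X) (x : X) (n : nat) : nat :=
  count (fun i => `[< F (iter i T x) >]) (iota 0 n).

Lemma visitsS F x n :
  visits F x n.+1 = visits F x n + `[< F (iter n T x) >].
Proof. by rewrite /visits -addn1 iotaD count_cat /= addn0. Qed.

Lemma visitsD F x m n :
  visits F x (m + n) = visits F x m + visits F (iter m T x) n.
Proof.
by elim: n => [|n IH]; rewrite ?addn0// addnS !visitsS IH addnA -iterD (addnC n m).
Qed.

Lemma leq_visits F x m n : m <= n -> visits F x m <= visits F x n.
Proof. by move=> /subnKC <-; rewrite visitsD leq_addr. Qed.

Lemma ltn_visits F x m n : F (iter m T x) -> m < n -> visits F x m < visits F x n.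
Proof.
by move=> Fm /(leq_visits F x); apply: leq_trans; rewrite visitsS asboolT // addn1.
Qed.

Lemma visits_inj F x m n : F (iter m T x) -> F (iter n T x) ->
  visits F x m = visits F x n -> m = n.
Proof.
by move=> Fm Fn; case: (ltngtP m n) => // /(@ltn_visits F x) => [/(_ Fm)|/(_ Fn)]; lia.
Qed.

Lemma nth_visit F x c n : c < visits F x n ->
  exists2 m, m < n & F (iter m T x) /\ visits F x m = c.
Proof.
elim: n => // n IH; rewrite visitsS => cn1.
have [/IH[m mn ?]|cn] := ltnP c (visits F x n).
  by exists m => //; exact: ltnW.
have [Fn|nF] := asboolP (F (iter n T x)); last by move: cn1; rewrite asboolF //; lia.
by exists n => //; split=> //; move: cn1; rewrite asboolT //; lia.
Qed.

Lemma visits_pos F x n : 0 < visits F x n -> exists2 m, m < n & F (iter m T x).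
Proof. by move=> /nth_visit[m mn [Fm _]]; exists m. Qed.

Lemma eq_visits F G x n : (forall i, i < n -> F (iter i T x) <-> G (iter i T x)) ->
  visits F x n = visits G x n.
Proof.
move=> FG; apply: eq_in_count => i; rewrite mem_iota add0n /= => ir.
by apply/asbool_equiv_eq; exact: FG.
Qed.

Lemma visitsDl F G x n : (F `<=` G) ->
  visits G x n = visits F x n + visits (G `\` F) x n.
Proof.
move=> FG; elim: n => // n IH; rewrite !visitsS IH.
have [Fn|nFn] := asboolP (F (iter n T x)).
  by rewrite asboolT ?asboolF//; [lia|case|exact: FG].
have [Gn|nGn] := asboolP (G (iter n T x)).
  by rewrite asboolT//; lia.
by rewrite asboolF; [lia|case].
Qed.

End Visits.

(** * Storing bits in the blocks of sparse points *)

Lemma iter_cancel (X : Type) (T U : X -> X) (n : nat) :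
  cancel T U -> cancel (iter n T) (iter n U).
Proof.
by move=> TK; elim: n => [|n IH] x //; rewrite (iterSr n U) iterS TK.
Qed.

Lemma iter_closed (X : Type) (f : X -> X) (Y : set X) :
  (forall x, Y x -> Y (f x)) -> forall n x, Y x -> Y (iter n f x).
Proof. by move=> Yf n x Yx; elim: n => //= n; exact: Yf. Qed.

Section Matching.
Variables (X : Type) (T U : X -> X).
Hypotheses (TK : cancel T U) (UK : cancel U T).

Lemma iter_inj n : injective (iter n T).
Proof. exact: (can_inj (iter_cancel n TK)). Qed.

Lemma iter_eq_sub m n s t : m <= n -> iter m T s = iter n T t ->
  s = iter (n - m) T t.
Proof. by move=> mn; rewrite -{1}(subnKC mn) iterD => /iter_inj. Qed.

(** Time 0 is left out because [s] itself lies in [R]; together with [R s] this says that the block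
    of [T^n s] starts at [s]. *)
Definition no_return (R : set X) n s := forall i, 0 < i <= n -> ~ R (iter i T s).

Lemma no_return_sub (R R' : set X) n n' s : R' `<=` R -> n' <= n ->
  no_return R n s -> no_return R' n' s.
Proof.
move=> RR nn nr i /andP[i0 le_in] /RR; apply: nr.
by rewrite i0 (leq_trans le_in).
Qed.

(** The start of a block is the last visit to [R]: if [m < m'], then [s] would be a forbidden return
    of [s']. *)
Lemma block_start_uniq (R : set X) m m' s s' :
  R s -> R s' -> no_return R m s -> no_return R m' s' ->
  iter m T s = iter m' T s' -> s = s' /\ m = m'.
Proof.
wlog mm : m m' s s' / m <= m' => [wl|] Rs Rs' nr nr' e.
  have [mm|/ltnW mm] := leqP m m'; first exact: wl.
  by have [-> ->] := wl _ _ _ _ mm Rs' Rs nr' nr (esym e).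
have E := iter_eq_sub mm e; have [lt|ge] := ltnP m m'.
  by case: (nr' (m' - m)); rewrite -?E// subn_gt0 lt leq_subr.
have mE : m = m' by apply/eqP; rewrite eqn_leq mm.
by split=> //; move: E; rewrite mE subnn.
Qed.

(* The point [T^n s] of [A] and the point [T^m s] of [F] lie in the [R]-block
   starting at [s] and have the same rank there. *)
Definition link (R A F : set X) n m s :=
  [/\ R s, no_return R (maxn n m) s, A (iter n T s), F (iter m T s) &
      visits T F s m = visits T A s n].

Definition matched R A F a j := exists n m s,
  [/\ link R A F n m s, a = iter n T s & j = iter m T s].

Lemma matched_funl R A F a a' j :
  matched R A F a j -> matched R A F a' j -> a = a'.
Proof.
move=> [n [m [s [[Rs nr An Fm cnt] -> ->]]]] [n' [m' [s' [[Rs' nr' An' Fm' cnt'] ->]]]].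
move=> /(block_start_uniq Rs Rs' (no_return_sub (@subset_refl _ R) (leq_maxr n m) nr)
  (no_return_sub (@subset_refl _ R) (leq_maxr n' m') nr'))[? ?].
subst s' m'; congr (iter _ T s).
by apply: visits_inj An An' _; rewrite -cnt -cnt'.
Qed.

Lemma matched_funr R A F a j j' :
  matched R A F a j -> matched R A F a j' -> j = j'.
Proof.
move=> [n [m [s [[Rs nr An Fm cnt] -> ->]]]] [n' [m' [s' [[Rs' nr' An' Fm' cnt'] + ->]]]].
move=> /(block_start_uniq Rs Rs' (no_return_sub (@subset_refl _ R) (leq_maxl n m) nr)
  (no_return_sub (@subset_refl _ R) (leq_maxl n' m') nr'))[? ?].
subst s' n'; congr (iter _ T s).
by apply: visits_inj Fm Fm' _; rewrite cnt -cnt'.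
Qed.

(* Both ends of a link lie in the same block of [R], hence in the same block of
   any coarser [S]. *)
Lemma visits_matched (R S A F : set X) s r : S `<=` R -> S s ->
  no_return S r.-1 s -> S (iter r T s) ->
  visits T [set j | exists a, matched R A F a j] s r <= visits T A s r.
Proof.
move=> SR Ss nr Sr.
apply: (@leq_count_injective_rel _ _ _
  (fun i i' => matched R A F (iter i' T s) (iter i T s))); last first.
  move=> i i' j ir i'r Li Li'.
  have nrS l : l < r -> no_return S l s by move=> lr; apply: no_return_sub nr => //; lia.
  by have [] := block_start_uniq Ss Ss (nrS _ ir) (nrS _ i'r) (matched_funr Li Li').
move=> i ir /asboolP[a [n [m [t [[Rt nrt At Ft cnt] aE iE]]]]].
(* As [s] lies in [R], the [R]-block starting at [t] cannot begin before [s]. *)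
have mi : m <= i.
  rewrite leqNgt; apply/negP => im.
  have E := iter_eq_sub (ltnW im) iE.
  by apply: (nrt (m - i)); [rewrite subn_gt0 im /=; lia|rewrite -E; exact: SR].
have E := iter_eq_sub mi (esym iE).
exists (i - m + n); split.
(* As [T^r s] lies in [R], that block is over by time [r]. *)
- rewrite ltnNge; apply/negP => rl.
  apply: (nrt (r - (i - m))); first lia.
  by apply: SR; rewrite E -iterD subnK//; lia.
- by apply/asboolP; rewrite addnC iterD -E.
- by exists n, m, t; split => //; rewrite addnC iterD -E.
Qed.

Variables (Y A : set X).
Hypothesis AY : A `<=` Y.
Hypotheses (YT : forall x, Y x -> Y (T x)).

Definition sparse w := [set x | Y x /\ forall n, 0 < n -> w * visits T A x n < n].

Lemma sparse_sub w w' : w <= w' -> sparse w' `<=` sparse w.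
Proof.
move=> ww x [Yx h]; split=> // n n0; apply: leq_ltn_trans (h n n0).
by rewrite leq_mul2r ww orbT.
Qed.

Hypotheses
  (sparse_forward : forall w x, Y x -> exists n, sparse w (iter n T x))
  (sparse_backward : forall w x, Y x -> exists n, sparse w (iter n U x)).

(** The offset 2: in a block, [A] and the [k] earlier levels take up at most [k.+1] times the number
    of points of [A], and level [k] needs that number once more. *)
Fixpoint free k : set X :=
  if k is k'.+1 then
    free k' `\` [set j | exists a, matched (sparse k'.+2) A (free k') a j]
  else Y `\` A.

Definition level k := matched (sparse k.+2) A (free k).

Lemma free_sub k l : k <= l -> free l `<=` free k.
Proof.
by move=> /subnKC <-; elim: (l - k) => [|i IH]; rewrite ?addn0// addnS => x [/IH].
Qed.

Lemma level_free k a j : level k a j -> free k j.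
Proof. by move=> [n [m [s [[? ? ? ? ?] _ ->]]]]. Qed.

(** A place used at one level is removed from all later free sets, so it determines its level;
    within a level it determines its owner. *)
Lemma level_inj k l a b j : level k a j -> level l b j -> k = l /\ a = b.
Proof.
move=> ka lb; have [kl|lk|kl] := ltngtP k l.
- by have [_ []] := free_sub kl (level_free lb); exists a.
- by have [_ []] := free_sub lk (level_free ka); exists b.
by move: lb; rewrite -kl => lb; split=> //; exact: matched_funl ka lb.
Qed.

Lemma block_start R x : (exists n, R (iter n U x)) ->
  exists n s, [/\ R s, no_return R n s & x = iter n T s].
Proof.
move=> ex; have {}ex : exists n, `[< R (iter n U x) >].
  by have [n ?] := ex; exists n; apply/asboolP.
pose n := ex_minn ex; exists n, (iter n U x); rewrite /n.
case: ex_minnP => {}n /asboolP Rn nmin.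
split=> //; last by rewrite (iter_cancel n UK).
move=> i /andP[i0 le_in] Ri.
have : n <= n - i.
  apply: nmin; apply/asboolP; move: Ri.
  by rewrite -{1}(subnKC le_in) iterD (iter_cancel i UK).
lia.
Qed.

Lemma block_end R s : (exists n, R (iter n T (T s))) ->
  exists r, [/\ 0 < r, R (iter r T s) & no_return R r.-1 s].
Proof.
move=> ex; have {}ex : exists n, `[< R (iter n.+1 T s) >].
  by have [n ?] := ex; exists n; apply/asboolP; rewrite iterSr.
pose n := ex_minn ex; exists n.+1; rewrite /n.
case: ex_minnP => {}n /asboolP Rn nmin; split=> // i /= /andP[i0 le_in] Ri.
have : n <= i.-1 by apply: nmin; rewrite prednK//; apply/asboolP.
lia.
Qed.

(** Induction on [l]: [free 0] loses the visits to [A], and by [visits_matched] each further level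
    loses at most as many again, since [sparse w] is contained in the sparse set of that level. *)
Lemma visits_free l w s r : l < w -> sparse w s -> no_return (sparse w) r.-1 s ->
  sparse w (iter r T s) -> r <= visits T (free l) s r + l.+1 * visits T A s r.
Proof.
move=> + Rs nr Rr; elim: l => [|l IH] lw.
  rewrite mul1n addnC -visitsDl//.
  have -> : visits T Y s r = count xpredT (iota 0 r).
    by apply: eq_count => i; rewrite asboolT//; apply: iter_closed; case: Rs.
  by rewrite count_predT size_iota.
have := IH (ltnW lw); move/leq_trans; apply.
have -> : visits T (free l) s r = visits T (free l.+1) s r +
    visits T (free l `\` free l.+1) s r by apply: visitsDl; exact: free_sub.
rewrite (mulSn l.+1) -!addnA leq_add2l leq_add2r.
apply: leq_trans (@visits_matched (sparse l.+2) (sparse w) A (free l) s r _ Rs nr Rr).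
  apply: sub_count => i /asboolP[fl nfl]; apply/asboolP.
  by apply: contrapT => h; apply: nfl; split.
exact: sparse_sub.
Qed.

Lemma level_total k a : A a -> exists j, level k a j.
Proof.
move=> Aa; have Ya := AY Aa.
have [n [s [Rs nr aE]]] := block_start (sparse_backward k.+2 Ya).
have [Ys Rs'] := Rs.
have [r [r0 Rr nrr]] := block_end (sparse_forward k.+2 (YT Ys)).
have nltr : n < r.
  by rewrite ltnNge; apply/negP => rn; apply: (nr r); rewrite ?r0.
have rA := Rs' _ r0.
have An : A (iter n T s) by rewrite -aE.
have lt : visits T A s n < visits T A s r by exact: ltn_visits.
have : r <= visits T (free k) s r + k.+1 * visits T A s r.
  exact: visits_free.
(* With [p] points of [A] and [q] free points in the block, [(k+2) p < r <= q + (k+1) p], so [p < q]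
   and some free point has the rank of [a]. *)
move: rA; rewrite (mulSn k.+1) => rA rF.
have lt' : visits T A s n < visits T (free k) s r by lia.
have [m mr [Fm cnt]] := nth_visit lt'.
exists (iter m T s), n, m, s; split=> //; split=> //.
by apply: no_return_sub nrr => //; lia.
Qed.

End Matching.

(** * Replacing A on orbits with a Borel selector *)

Section Thinning.
Variables (X : Type) (T U : X -> X).
Hypotheses (TK : cancel T U) (UK : cancel U T).

Definition saturation (D : set X) : set X :=
  [set x | exists n, D (iter n T x) \/ D (iter n U x)].

Lemma saturationT D x : saturation D (T x) = saturation D x.
Proof.
apply/propext; split=> -[n [Dn|Dn]].
- by exists n.+1; left; rewrite iterSr.
- case: n Dn => [|n] Dn; first by exists 1; left.
  by exists n; right; move: Dn; rewrite iterSr TK.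
- case: n Dn => [|n] Dn; first by exists 1; right; rewrite /= TK.
  by exists n; left; rewrite -iterSr.
- by exists n.+1; right; rewrite iterSr TK.
Qed.

Lemma saturation_iterT D x n : saturation D (iter n T x) = saturation D x.
Proof. by elim: n => //= n IH; rewrite saturationT. Qed.

Lemma saturation_iterU D x n : saturation D (iter n U x) = saturation D x.
Proof. by rewrite -(saturation_iterT _ _ n) (iter_cancel n UK). Qed.

Lemma mem_saturation (D : set X) x : D x -> saturation D x.
Proof. by exists 0; left. Qed.

(** A segment violating sparsity at [T^n x], appended to the first [n] steps, would contradict the
    maximality of [n]. *)
Lemma sparse_forward (Y A : set X) (YT : forall x, Y x -> Y (T x)) w x : Y x ->
  (exists N, forall n, N < n -> w * visits T A x n < n) ->
  exists n, sparse T Y A w (iter n T x).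
Proof.
move=> Yx [N hN].
have ex : exists n, n <= w * visits T A x n by exists 0.
have bd n : n <= w * visits T A x n -> n <= N.
  by move=> h; rewrite leqNgt; apply/negP => /hN; lia.
exists (ex_maxn ex bd); case: ex_maxnP => n hn nmax.
split; first exact: iter_closed.
move=> m m0; rewrite ltnNge; apply/negP => hm.
have : n + m <= n by apply: nmax; rewrite visitsD mulnDr leq_add.
lia.
Qed.

Variables (Y A : set X).
Hypothesis AY : A `<=` Y.
Hypotheses (YT : forall x, Y x -> Y (T x)) (YU : forall x, Y x -> Y (U x)).
Hypothesis YA : Y `<=` saturation A.
Hypothesis A_density0 : forall w x, Y x ->
  exists N, forall n, N < n -> w * visits T A x n < n.

Definition first_sparse w : set X := [set x | sparse T Y A w x /\
  forall n, 0 < n -> ~ sparse T Y A w (iter n U x)].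

(** The least [w] is taken because the first points for different [w] may differ on one orbit. *)
Definition selector : set X := [set x | exists w, first_sparse w x /\
  forall v, v < w -> ~ saturation (first_sparse v) x].

Definition selected : set X := [set x | exists w, saturation (first_sparse w) x].

Definition thinning : set X := [set x | A x /\ ~ selected x \/ selector x].

Lemma selected_iterT x n : selected (iter n T x) = selected x.
Proof.
by apply/propext; split=> -[w sw]; exists w; move: sw; rewrite saturation_iterT.
Qed.

Lemma selected_iterU x n : selected (iter n U x) = selected x.
Proof.
by apply/propext; split=> -[w sw]; exists w; move: sw; rewrite saturation_iterU.
Qed.

Lemma selector_selected x : selector x -> selected x.
Proof. by move=> [w [/mem_saturation ? _]]; exists w. Qed.

(** Both points would have the same least [w], by invariance of saturations; the earlier one then
    precedes a first point of [sparse w]. *)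
Lemma selector_wandering x n : 0 < n -> selector x -> ~ selector (iter n T x).
Proof.
move=> n0 [w [fw minw]] [v [fv minv]].
have wv : w = v.
  case: (ltngtP w v) => // [/minv|/minw]; case.
    by rewrite saturation_iterT; exact: mem_saturation.
  by rewrite -(saturation_iterT _ _ n); exact: mem_saturation.
have [_ /(_ n n0)] := fv; rewrite (iter_cancel n TK) -wv; case: fw => *; exact.
Qed.

Lemma thinningY : thinning `<=` Y.
Proof. by move=> x [[/AY]|[w [[[]]]]]. Qed.

Lemma selected_selector x : selected x -> saturation selector x.
Proof.
move=> [w0 sw0].
have ex : exists w, `[< saturation (first_sparse w) x >] by exists w0; apply/asboolP.
have [w /asboolP[n sw] wmin] := ex_minnP ex.
have nsat v : v < w -> ~ saturation (first_sparse v) x.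
  by move=> vw sv; have := wmin v (asboolT sv); lia.
by exists n; case: sw => sw; [left|right]; exists w; split=> // v /nsat;
  rewrite ?saturation_iterT ?saturation_iterU.
Qed.

Lemma saturation_thinning : Y `<=` saturation thinning.
Proof.
move=> x /YA Ax; have [/selected_selector[n [s|s]]|ns] := pselect (selected x).
- by exists n; left; right.
- by exists n; right; right.
case: Ax => n [An|An]; exists n; [left|right]; left; split=> //.
  by rewrite selected_iterT.
by rewrite selected_iterU.
Qed.

Lemma visits_thinning_unselected x n : ~ selected x ->
  visits T thinning x n = visits T A x n.
Proof.
move=> nsx; apply: eq_visits => i _; split=> [[[]//|/selector_selected]|Ai].
  by rewrite selected_iterT.
by left; rewrite selected_iterT.
Qed.

Lemma visits_thinning_selected x n : selected x -> visits T thinning x n <= 1.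
Proof.
move=> sx.
have -> : visits T thinning x n = visits T selector x n.
  by apply: eq_visits => i _; split=> [[[_]|//]|]; [rewrite selected_iterT|right].
elim: n => // n IH; rewrite visitsS.
have [Sn|nSn] := asboolP (selector (iter n T x)); last by rewrite addn0.
case: (posnP (visits T selector x n)) => [->//|v0]; have [m mn Sm] := visits_pos v0.
have := @selector_wandering (iter m T x) (n - m); rewrite subn_gt0 => /(_ mn Sm).
by rewrite -iterD subnK ?(ltnW mn).
Qed.

Lemma thinning_forward w x : Y x -> exists n, sparse T Y thinning w (iter n T x).
Proof.
move=> Yx; apply: sparse_forward => //.
have [sx|nsx] := pselect (selected x); last first.
  have [N hN] := A_density0 w Yx.
  by exists N => n /hN; rewrite visits_thinning_unselected.
(* There is at most one visit, so any time beyond [w] will do. *)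
exists w => n wn; apply: leq_ltn_trans wn.
by rewrite -{2}(muln1 w) leq_mul2l visits_thinning_selected ?orbT.
Qed.

Lemma thinning_backward w x : Y x -> exists n, sparse T Y thinning w (iter n U x).
Proof.
move=> Yx; have [sx|nsx] := pselect (selected x); last first.
  have eq_sparse y : selected y = selected x ->
      sparse T Y thinning w y = sparse T Y A w y.
    move=> sy; apply/propext; split=> -[Yy h]; split=> // n /h;
      by rewrite visits_thinning_unselected// sy.
  (* Without a sparse point in the past, the first one in the future would be the first of the whole
     orbit, which would then be selected. *)
  apply: contrapT => no; apply: nsx; exists w.
  have ex : exists n, `[< sparse T Y A w (iter n T x) >].
    have [n ?] := sparse_forward YT Yx (A_density0 w Yx).
    by exists n; apply/asboolP.
  have [n /asboolP sn nmin] := ex_minnP ex; exists n; left; split=> // i i0 si.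
  have [le_in|lt_ni] := leqP i n.
    have : n <= n - i.
      apply: nmin; apply/asboolP; move: si.
      by rewrite -{1}(subnKC le_in) iterD (iter_cancel i TK).
    lia.
  apply: no; exists (i - n); rewrite eq_sparse ?selected_iterU//.
  by move: si; rewrite -{1}(subnK (ltnW lt_ni)) iterD (iter_cancel n TK).
(* One of [U^w x] and [x] is sparse: if the former is not, the only visit from there on happens
   within its first [w] steps, hence before [x], and none is left from [x] on. *)
have [sw|nsw] := pselect (sparse T Y thinning w (iter w U x)); first by exists w.
exists 0; split=> // n n0 /=.
have [m m0 hm] : exists2 m, 0 < m & m <= w * visits T thinning (iter w U x) m.
  apply: contrapT => no; apply: nsw; split; first exact: (iter_closed YU).
  by move=> m m0; rewrite ltnNge; apply/negP => ?; apply: no; exists m.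
have le1 k : visits T thinning (iter w U x) k <= 1.
  by apply: visits_thinning_selected; rewrite selected_iterU.
have mw : m <= w by apply: leq_trans hm _; rewrite -{3}(muln1 w) leq_mul2l le1 orbT.
have v1 : 0 < visits T thinning (iter w U x) w.
  apply: leq_trans (leq_visits _ _ _ mw); case: (visits _ _ _ m) hm => //; lia.
have := le1 (w + n); rewrite visitsD (iter_cancel w UK) => le2.
have -> : visits T thinning x n = 0 by lia.
by rewrite muln0.
Qed.

End Thinning.

(** * Measurability *)

(** This serves twice: for the Borel sets, to show that the code is Borel, and for the sets
    generated by the code, to carry out the decoding. *)
Definition invariant_sigma (X : Type) (T U : X -> X) (M : set (set X)) :=
  [/\ sigma_algebra setT M, forall C, M C -> M (T @^-1` C) &
      forall C, M C -> M (U @^-1` C)].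

Section Measurability.
Variables (X : Type) (T U : X -> X) (M : set (set X)).
Hypothesis hM : invariant_sigma T U M.
Hypotheses (TK : cancel T U) (UK : cancel U T).

Lemma sigma_not (P : X -> Prop) : M [set x | P x] -> M [set x | ~ P x].
Proof.
by case: hM => -[_ MC _] _ _ /MC; rewrite setTD.
Qed.

Lemma sigma_exists (P : nat -> X -> Prop) :
  (forall n, M [set x | P n x]) -> M [set x | exists n, P n x].
Proof.
case: hM => -[_ _ MU] _ _ /MU; congr M; apply/seteqP; split=> x.
  by move=> [n _ ?]; exists n.
by move=> [n ?]; exists n.
Qed.

Lemma sigma_forall (P : nat -> X -> Prop) :
  (forall n, M [set x | P n x]) -> M [set x | forall n, P n x].
Proof.
move=> MP; have -> : [set x | forall n, P n x] = [set x | ~ exists n, ~ P n x].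
  by apply/seteqP; split=> x /=; rewrite -forallNE => h n; [apply|apply: contrapT].
by apply: sigma_not; apply: sigma_exists => n; exact: sigma_not.
Qed.

Lemma sigma_or (P Q : X -> Prop) :
  M [set x | P x] -> M [set x | Q x] -> M [set x | P x \/ Q x].
Proof.
move=> MP MQ.
have -> : [set x | P x \/ Q x] = [set x | exists n, if n is 0 then P x else Q x].
  apply/seteqP; split=> x /=; first by move=> [?|?]; [exists 0|exists 1].
  by move=> [[|n] ?]; [left|right].
by apply: sigma_exists => -[|n].
Qed.

Lemma sigma_and (P Q : X -> Prop) :
  M [set x | P x] -> M [set x | Q x] -> M [set x | P x /\ Q x].
Proof.
move=> MP MQ.
have -> : [set x | P x /\ Q x] = [set x | ~ (~ P x \/ ~ Q x)].
  by apply/seteqP; split=> x /=; rewrite not_orE !notK.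
by apply: sigma_not; apply: sigma_or; exact: sigma_not.
Qed.

Lemma sigma_cst (P : Prop) : M [set _ | P].
Proof.
case: hM => -[M0 _ _] _ _; have [p|np] := pselect P.
  have -> : [set _ | P] = [set x : X | ~ False] by apply/seteqP; split=> x //= _ [].
  exact: (@sigma_not (fun=> False)).

by have -> : [set _ | P] = set0 :> set X by apply/seteqP; split=> x.
Qed.

Lemma sigma_imply (P : Prop) (Q : X -> Prop) :
  (P -> M [set x | Q x]) -> M [set x | P -> Q x].
Proof.
move=> MQ; have [p|np] := pselect P.
  have -> : [set x | P -> Q x] = [set x | Q x]; last exact: MQ.
  by apply/seteqP; split=> x //= /(_ p).
have -> : [set x | P -> Q x] = [set _ | True] by apply/seteqP; split=> x //= _ /np.
exact: sigma_cst.
Qed.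

Lemma sigma_iterT (C : set X) n : M C -> M [set x | C (iter n T x)].
Proof.
case: hM => _ MT _ MC; elim: n => // n /MT; congr M.
by apply/seteqP; split=> x /=; rewrite -iterSr.
Qed.

Lemma sigma_iterU (C : set X) n : M C -> M [set x | C (iter n U x)].
Proof.
case: hM => _ _ MU MC; elim: n => // n /MU; congr M.
by apply/seteqP; split=> x /=; rewrite -iterSr.
Qed.

(** [Q] varies in the induction, because a visit at the last time shifts it by one. *)
Lemma sigma_visits (F : set X) (Q : nat -> Prop) n : M F ->
  M [set x | Q (visits T F x n)].
Proof.
move=> MF; elim: n Q => [|n IH] Q; first exact: (sigma_cst (Q 0)).
have -> : [set x | Q (visits T F x n.+1)] =
    [set x | (F (iter n T x) /\ Q (visits T F x n).+1) \/
             (~ F (iter n T x) /\ Q (visits T F x n))].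
  apply/seteqP; split=> x /=; rewrite visitsS;
  have [Fn|nFn] := asboolP (F (iter n T x)); rewrite ?addn1 ?addn0; try tauto.
by apply: sigma_or; apply: sigma_and;
  [exact: sigma_iterT|exact: (IH (fun c => Q c.+1))
  |apply: sigma_not; exact: sigma_iterT|exact: IH].
Qed.

Lemma sigma_saturation (D : set X) : M D -> M (saturation T U D).
Proof.
by move=> MD; apply: sigma_exists => n; apply: sigma_or; [exact: sigma_iterT|exact: sigma_iterU].
Qed.

Lemma sigma_link (R A F : set X) n m : M R -> M A -> M F ->
  M [set s | link T R A F n m s].
Proof.
move=> MR MA MF.
(* The equality of two counts is split over their common value [c], so that each count is compared
   with a constant. *)
have -> : [set s | link T R A F n m s] = [set s | R s /\
    ((forall i, 0 < i <= maxn n m -> ~ R (iter i T s)) /\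
    (A (iter n T s) /\ (F (iter m T s) /\
    exists c, visits T F s m = c /\ visits T A s n = c)))].
  apply/seteqP; split=> s /=.
    by move=> [? ? ? ? ?]; do 4 split=> //; exists (visits T A s n).
  by move=> [? [? [? [? [c [? ?]]]]]]; split=> //; congruence.
apply: sigma_and => //; apply: sigma_and.
  apply: sigma_forall => i; apply: sigma_imply => _; apply: sigma_not.
  exact: sigma_iterT.
apply: sigma_and; first exact: sigma_iterT.
apply: sigma_and; first exact: sigma_iterT.
apply: sigma_exists => c.
by apply: sigma_and; exact: (sigma_visits (fun v => v = c)).
Qed.

(** The block start is recovered as [U^m j], so only [n] and [m] are quantified and no projection of
    a Borel set occurs. For preimages it is [U^n a]. *)
Lemma sigma_matched_image (R A F C : set X) : M R -> M A -> M F -> M C ->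
  M [set j | exists a, matched T R A F a j /\ C a].
Proof.
move=> MR MA MF MC.
have -> : [set j | exists a, matched T R A F a j /\ C a] = [set j | exists n m,
    link T R A F n m (iter m U j) /\ C (iter n T (iter m U j))].
  apply/seteqP; split=> j /=.
    move=> [_ [[n [m [s [ls -> ->]]]] Ca]]; exists n, m.
    by rewrite (iter_cancel m TK).
  move=> [n [m [lj Cj]]]; exists (iter n T (iter m U j)); split=> //.
  by exists n, m, (iter m U j); split=> //; rewrite (iter_cancel m UK).
apply: sigma_exists => n; apply: sigma_exists => m; apply: sigma_and.
  exact: (@sigma_iterU [set s | link T R A F n m s] m (sigma_link n m MR MA MF)).
exact: (@sigma_iterU [set s | C (iter n T s)] m (sigma_iterT n MC)).
Qed.

Lemma sigma_matched_preimage (R A F E : set X) : M R -> M A -> M F -> M E ->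
  M [set a | exists j, matched T R A F a j /\ E j].
Proof.
move=> MR MA MF ME.
have -> : [set a | exists j, matched T R A F a j /\ E j] = [set a | exists n m,
    link T R A F n m (iter n U a) /\ E (iter m T (iter n U a))].
  apply/seteqP; split=> a /=.
    move=> [_ [[n [m [s [ls -> ->]]]] Ca]]; exists n, m.
    by rewrite (iter_cancel n TK).
  move=> [n [m [lj Cj]]]; exists (iter m T (iter n U a)); split=> //.
  by exists n, m, (iter n U a); split=> //; rewrite (iter_cancel n UK).
apply: sigma_exists => n; apply: sigma_exists => m; apply: sigma_and.
  exact: (@sigma_iterU [set s | link T R A F n m s] n (sigma_link n m MR MA MF)).
exact: (@sigma_iterU [set s | E (iter m T s)] n (sigma_iterT m ME)).
Qed.

Variables (Y A : set X).
Hypotheses (MY : M Y) (MA : M A).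

Lemma sigma_sparse w : M (sparse T Y A w).
Proof.
apply: sigma_and => //; apply: sigma_forall => n; apply: sigma_imply => _.
exact: (sigma_visits (fun v => w * v < n)).
Qed.

Lemma sigma_thinning : M (thinning T U Y A).
Proof.
have Mfirst w : M (first_sparse T U Y A w).
  apply: sigma_and; first exact: sigma_sparse.
  apply: sigma_forall => n; apply: sigma_imply => _; apply: sigma_not.
  by apply: sigma_iterU; exact: sigma_sparse.
apply: sigma_or.
  apply: sigma_and => //; apply: sigma_not; apply: sigma_exists => w.
  exact: sigma_saturation.
apply: sigma_exists => w; apply: sigma_and; first exact: Mfirst.
apply: sigma_forall => v; apply: sigma_imply => _; apply: sigma_not.
exact: sigma_saturation.
Qed.

Lemma sigma_free k : M (free T Y A k).
Proof.
elim: k => [|k IH] /=; apply: sigma_and => //; apply: sigma_not => //.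
have := sigma_matched_image (sigma_sparse k.+2) MA IH (sigma_cst True).
by congr M; apply/seteqP; split=> j [a]; [case|]; exists a.
Qed.

Lemma sigma_level_image k (C : set X) : M C ->
  M [set j | exists a, level T Y A k a j /\ C a].
Proof.
by move=> MC; apply: sigma_matched_image => //; [exact: sigma_sparse|exact: sigma_free].
Qed.

Lemma sigma_level_preimage k (E : set X) : M E ->
  M [set a | exists j, level T Y A k a j /\ E j].
Proof.
by move=> ME; apply: sigma_matched_preimage => //; [exact: sigma_sparse|exact: sigma_free].
Qed.

End Measurability.

(** * The generator *)

Lemma translateP (X : Type) (T U : X -> X) (TK : cancel T U) (UK : cancel U T) k D :
  translate T (Posz k) D = [set x | D (iter k U x)].
Proof.
apply/seteqP; split=> x /=; first by move=> [y Dy <-]; rewrite (iter_cancel k TK).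
by move=> Dx; exists (iter k U x) => //; rewrite (iter_cancel k UK).
Qed.

Lemma translate_preimageT (X : Type) (T U : X -> X)
    (TK : cancel T U) (UK : cancel U T) j D :
  exists j', T @^-1` (translate T j D) = translate T j' D.
Proof.
case: j => [[|k]|k].
- by exists (Negz 0); rewrite (translateP TK UK).
- exists (Posz k); rewrite !(translateP TK UK).
  by apply/seteqP; split=> x; rewrite /preimage /mkset iterSr TK.
- by exists (Negz k.+1); apply/seteqP; split=> x; rewrite /translate /preimage /mkset -iterSr.
Qed.

Lemma translate_preimageU (X : Type) (T U : X -> X)
    (TK : cancel T U) (UK : cancel U T) j D :
  exists j', U @^-1` (translate T j D) = translate T j' D.
Proof.
case: j => [k|[|k]].
- exists (Posz k.+1); rewrite !(translateP TK UK).
  by apply/seteqP; split=> x; rewrite /preimage /mkset -iterSr.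
- exists (Posz 0); rewrite !(translateP TK UK).
  by apply/seteqP; split=> x; rewrite /preimage /mkset /= UK.
- by exists (Negz k); apply/seteqP; split=> x; rewrite /translate /preimage /mkset (iterSr k.+1) UK.
Qed.

(** The sets with generated preimage form a sigma-algebra on [Y]: as [Y] is its own preimage,
    complements in [Y] pull back to complements in [Y]. *)
Lemma sigma_algebra_preimage (X : Type) (f : X -> X) (Y : set X) (G : set (set X)) :
  f @^-1` Y = Y -> (forall D, G D -> G (f @^-1` D)) ->
  forall D, <<s Y, G>> D -> <<s Y, G>> (f @^-1` D).
Proof.
move=> fY fG; have [S0 SC SU] := @smallest_sigma_algebra _ Y G.
apply: smallest_sub; last by move=> D /fG GD; exact: sub_gen_smallest.
split=> [|D|D]; rewrite /mkset ?preimage_set0 ?preimage_bigcup //.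
- have -> : f @^-1` (Y `\` D) = Y `\` f @^-1` D by rewrite -{2}fY.
  exact: SC.
- exact: SU.
Qed.

(** This turns a sigma-algebra on [Y] into one on [X], to which the measurability lemmas apply. *)
Lemma sigma_algebra_trace (X : Type) (Y : set X) (S : set (set X)) :
  sigma_algebra Y S -> sigma_algebra setT [set C | S (Y `&` C)].
Proof.
move=> [S0 SC SU]; split=> [|D|D]; rewrite /mkset ?setI0 ?setI_bigcupr//.
- by move=> /SC; rewrite setTD setDE setCI setIUr setICr set0U.
- exact: SU.
Qed.

Section Coding.
Variables (X : Type) (T U : X -> X) (B : set (set X)) (C : nat -> set X).
Hypotheses (TK : cancel T U) (UK : cancel U T) (hB : invariant_sigma T U B).
Hypothesis BC : forall k, B (C k).
Hypothesis Bmin : forall N, sigma_algebra setT N -> (forall k, N (C k)) -> B `<=` N.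
Variables (Y A : set X).
Hypotheses (BY : B Y) (BA : B A) (AY : A `<=` Y).
Hypotheses (YT : forall x, Y x -> Y (T x)) (YU : forall x, Y x -> Y (U x)).
Hypothesis YA : Y `<=` saturation T U A.
Hypotheses
  (sparseT : forall w x, Y x -> exists n, sparse T Y A w (iter n T x))
  (sparseU : forall w x, Y x -> exists n, sparse T Y A w (iter n U x)).

(** Bit [k] of a point of [A] is its membership in the generating set [C k]. *)
Definition code : set X := [set j | exists k a, level T Y A k a j /\ C k a].

Lemma codeY : code `<=` Y `\` A.
Proof. by move=> j [k [a [ka _]]]; exact: (free_sub (leq0n k) (level_free ka)). Qed.

(** By [level_total] each bit has a place, and by [level_inj] no other point or level can have
    marked it. *)
Lemma code_recovers k : A `&` C k = [set a | exists j, level T Y A k a j /\ code j].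
Proof.
apply/seteqP; split=> a /=.
  move=> [Aa Ca]; have [j aj] := level_total TK UK AY YT sparseT sparseU k Aa.
  by exists j; split=> //; exists k, a.
move=> [j [aj [l [b [bj Cb]]]]].
have [kl ab] := level_inj TK aj bj; subst l b; split=> //.
by case: aj => n [m [s [[_ _ An _ _] -> _]]].
Qed.

(** The default value of [nth] supplies the empty fourth member. *)
Definition code_partition (i : 'I_4) : set X :=
  nth set0 [:: A; code; Y `\` (A `|` code)] i.

Lemma has_set_generator4 : has_set_generator B T Y 4.
Proof.
have [[B0 BCpl BU] BT BUinv] := hB.
have BD D D' : B D -> B D' -> B (D `\` D').
  by move=> BD BD'; apply: (sigma_and hB) => //; apply: (sigma_not hB).
have Bcode : B code.
  apply: (sigma_exists hB) => k; exact: (sigma_level_image hB).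
have Bpart i : B (code_partition i).
  case: i => -[|[|[|[|//]]]] i_lt; rewrite /code_partition //=.
  by apply: BD => //; apply: (sigma_or hB).
exists code_partition; rewrite /is_set_generator.
set G := (X in <<s Y, X>>).
have [S0 SC SU] := @smallest_sigma_algebra _ Y G.
have partY i : code_partition i `<=` Y.
  case: i => -[|[|[|[|//]]]] i_lt; rewrite /code_partition //=.
  by move=> x /codeY[].
have TY : T @^-1` Y = Y.
  by apply/seteqP; split=> x; [move=> /YU; rewrite TK|exact: YT].
have UY : U @^-1` Y = Y.
  by apply/seteqP; split=> x; [move=> /YT; rewrite UK|exact: YU].
pose M := [set D | <<s Y, G>> (Y `&` D)].
have hM : invariant_sigma T U M.
  split; first exact: sigma_algebra_trace.
  - move=> D MD; rewrite /M /mkset -{2}TY -preimage_setI.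
    apply: sigma_algebra_preimage => // _ [j [i ->]].
    by have [j' ->] := translate_preimageT TK UK j (code_partition i); exists j', i.
  - move=> D MD; rewrite /M /mkset -{2}UY -preimage_setI.
    apply: sigma_algebra_preimage => // _ [j [i ->]].
    by have [j' ->] := translate_preimageU TK UK j (code_partition i); exists j', i.
have Mpart i : M (code_partition i).
  rewrite /M /mkset setIidr//; apply: sub_gen_smallest; exists (Posz 0), i.
  by rewrite (translateP TK UK).
have MA : M A by exact: (Mpart (@Ordinal 4 0 isT)).
have Mcode : M code by exact: (Mpart (@Ordinal 4 1 isT)).
have MY : M Y by rewrite /M /mkset setIid -[X in _ X]setD0; exact: SC.
(* The sets [D] with this property form a sigma-algebra, which contains every [C k] because the
   levels are computed from [A] and [Y] inside [M]. *)
have MAC D : B D -> M (A `&` D).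
  apply: (Bmin (N := [set D | M (A `&` D)])).
    split=> [|D'|D']; rewrite /mkset ?setI0 ?setI_bigcupr.
    - by case: hM => -[].
    - move=> MD'; rewrite setTD.
      have -> : A `&` ~` D' = A `&` ~` (A `&` D').
        by rewrite setCI setIUr setICr set0U.
      by apply: (sigma_and hM) => //; apply: (sigma_not hM).
    - by case: hM => -[_ _ MU] _ _ ?; exact: MU.
  by move=> k; rewrite /mkset code_recovers; apply: (sigma_level_preimage hM).
split=> //.
- have Acode x : A x -> code x -> False by move=> Ax /codeY[].
  have rest0 x : (Y `\` (A `|` code)) x -> A x -> False by move=> [_ n] ?; apply: n; left.
  have rest1 x : (Y `\` (A `|` code)) x -> code x -> False.
    by move=> [_ n] ?; apply: n; right.
  move=> [[|[|[|[|//]]]] i_lt] [[|[|[|[|//]]]] j_lt] _ _ [x []];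
    rewrite /code_partition /=; move=> h h'; try exact/val_inj; exfalso;
    first [exact: h | exact: h' | exact: Acode h h' | exact: Acode h' h
          | exact: rest0 h h' | exact: rest0 h' h | exact: rest1 h h' | exact: rest1 h' h].
- apply/seteqP; split=> x; first by move=> [i _ /partY].
  move=> Yx; have [Ax|nAx] := pselect (A x); first by exists (@Ordinal 4 0 isT).
  have [Ex|nEx] := pselect (code x); first by exists (@Ordinal 4 1 isT).
  by exists (@Ordinal 4 2 isT) => //; split=> // -[].
apply/seteqP; split.
  apply: smallest_sub.
    split=> [|D [BD' DY]|D BDY]; first by split.
    - by split; [exact: BD|move=> x []].
    - split; first by apply: BU => n; case: (BDY n).
      by move=> x [n _]; case: (BDY n) => _; exact.
  move=> _ [j [i ->]]; split.
    case: j => k; last exact: (sigma_iterT hB k.+1 (Bpart i)).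
    by rewrite (translateP TK UK); exact: (sigma_iterU hB).
  case: j => k.
    rewrite (translateP TK UK) => x /partY /(iter_closed YT k).
    by rewrite (iter_cancel k UK).
  move=> x /partY /(iter_closed YU k.+1).
  by rewrite (iter_cancel k.+1 TK).
move=> D [BD' DY].
suff : M D by rewrite /M /mkset setIidr.
(* Every orbit in [Y] meets [A], so membership in [D] can be tested at a point of [A] on the orbit,
   where [MAC] applies. *)
have -> : D = [set x | exists n,
    (Y x /\ (A `&` [set y | D (iter n U y)]) (iter n T x)) \/
    (Y x /\ (A `&` [set y | D (iter n T y)]) (iter n U x))].
  apply/seteqP; split=> x.
    move=> Dx; have Yx := DY _ Dx; have [n [An|An]] := YA Yx; exists n; [left|right];
    split=> //; split=> //=.
      by rewrite (iter_cancel n TK).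
    by rewrite (iter_cancel n UK).
  move=> [n [[_ [_ /=]]|[_ [_ /=]]]]; first by rewrite (iter_cancel n TK).
  by rewrite (iter_cancel n UK).
apply: (sigma_exists hM) => n; apply: (sigma_or hM); apply: (sigma_and hM) => //.
  by apply: (sigma_iterT hM); apply: MAC; exact: (sigma_iterU hB).
by apply: (sigma_iterU hM); apply: MAC; exact: (sigma_iterT hB).
Qed.

End Coding.

(** * The null part of a standard Borel system *)

(** The basis consists of the interiors of balls of radius [1/(n+1)] about the points of a countable
    dense set, indexed by encoded pairs. *)
Lemma separable_countable_basis (R : realType) (Y : metricType R) :
  (exists2 D : set Y, countable D & dense D) ->
  exists W : nat -> set Y, (forall k, open (W k)) /\
    forall V, open V -> V = \bigcup_(k in [set k | W k `<=` V]) W k.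
Proof.
move=> [D /countable_injP[g ginj] Ddense].
pose rad n : R := (n.+1%:R^-1)%R.
pose W k : set Y := if unpickle k is Some (i, n) then
  \bigcup_(d in [set d | D d /\ g d = i]) (ball d (rad n))° else set0.
exists W; split.
  move=> k; rewrite /W; case: unpickle => [[i n]|]; last exact: open0.
  by apply: bigcup_open => d _; exact: open_interior.
move=> V Vo; apply/seteqP; split=> x; last by move=> [k kV]; exact: kV.
move=> Vx.
have /nbhs_ballP[e /= e0 eV] : nbhs x V by exact: open_nbhs_nbhs.
(* With [rad n < e/2] and [d] within [rad n / 2] of [x], the ball of radius [rad n] about [d] is a
   neighbourhood of [x] inside the ball of radius [e] about [x]. *)
have [|n] := @ltr_add_invr R 0%R (e / 2)%R; first by rewrite divr_gt0.
rewrite add0r -/(rad n) => hn.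
have rad0 : (0 < rad n / 2)%R by rewrite divr_gt0 ?invr_gt0 ?ltr0n.
have [|d [/interior_subset xd Dd]] := Ddense (ball x (rad n / 2)%R)° _ (open_interior _).
  by exists x; exact: nbhsx_ballx.
have Wk : W (pickle (g d, n)) = (ball d (rad n))°.
  rewrite /W pickleK; apply/seteqP; split=> y; last by exists d.
  by move=> [d' [Dd' gd]]; rewrite -(ginj _ _ _ _ gd) ?inE.
exists (pickle (g d, n)); rewrite /mkset Wk.
  move=> z /interior_subset dz; apply: eV.
  apply: le_ball (ball_triangle xd dz); rewrite [leRHS]splitr lerD ?(ltW hn)//.
  by apply: le_trans (ltW hn); rewrite ler_pdivrMr// ler_peMr ?ler1n// ltW ?invr_gt0 ?ltr0n.
have := nbhsx_ballx x _ rad0; apply: filterS => y xy.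
by rewrite [rad n]splitr; exact: ball_triangle (ball_sym xd) xy.
Qed.

Lemma standard_borel_sigma_algebra (R : realType) (X : Type) (B : set (set X)) :
  standard_borel R B -> sigma_algebra setT B.
Proof.
move=> [Y [f [_ _ BE]]]; have [S0 SC SU] := @smallest_sigma_algebra _ setT (@open Y).
split=> [|C /BE BC|C BC]; apply/BE.
- by rewrite preimage_set0.
- exact: SC.
- by rewrite preimage_bigcup; apply: SU => n; apply/BE.
Qed.

Lemma standard_borel_countably_generated (R : realType) (X : Type) (B : set (set X)) :
  standard_borel R B ->
  exists C : nat -> set X, (forall k, B (C k)) /\
    forall N, sigma_algebra setT N -> (forall k, N (C k)) -> B `<=` N.
Proof.
move=> [Y [f [[_ /separable_countable_basis[W [Wo Wbasis]]] [g fK gK] BE]]].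
have imE V : f @` V = g @^-1` V.
  by apply/seteqP; split=> x; [move=> [y Vy <-]; rewrite /preimage /mkset fK|exists (g x)].
exists (fun k => f @` W k); split=> [k|N [N0 NC NU] NW].
  apply/BE; apply: sub_gen_smallest; rewrite imE.
  by rewrite (_ : f @^-1` _ = W k)//; apply/seteqP; split=> y; rewrite /preimage /mkset fK.
suff : <<s @open Y>> `<=` [set V | N (f @` V)].
  move=> sub C /BE/sub; rewrite /mkset imE.
  by rewrite (_ : g @^-1` _ = C)//; apply/seteqP; split=> x; rewrite /preimage /mkset gK.
apply: smallest_sub.
  split=> [|V|V]; rewrite /mkset ?image_set0 ?image_bigcup//; last exact: NU.
  by rewrite !imE => /NC.
(* Basis sets not contained in [V] are replaced by the empty set, which makes the union a
   sequence. *)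
move=> V /Wbasis ->; rewrite /mkset image_bigcup bigcup_mkcond; apply: NU => k.
case: ifP => _.
  exact: NW.
exact: N0.
Qed.

Section NullPart.
Variables (X : Type) (T U : X -> X).
Hypotheses (TK : cancel T U) (UK : cancel U T).

(** For positive [w], the visit frequency is eventually below [1/w]; in this form only natural
    numbers are quantified, which gives measurability. *)
Definition density0 (A : set X) : set X :=
  [set x | forall w, exists N, forall n, N < n -> w * visits T A x n < n].

Lemma cvg_density0 (R : realType) A x :
  ((fun n : nat => n%:R^-1 * \sum_(0 <= i < n) (\1_A (iter i T x) : R))%R
      @ \oo --> (0 : R)%R) <-> density0 A x.
Proof.
have -> : (fun n : nat => n%:R^-1 * \sum_(0 <= i < n) (\1_A (iter i T x) : R))%R =
    (fun n => n%:R^-1 * (visits T A x n)%:R)%R.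
  apply: funext => n; congr (_ * _)%R; elim: n => [|n IH].
    by rewrite big_geq.
  by rewrite big_nat_recr//= IH visitsS natrD indicE.
split.
  move=> /cvgr0Pnorm_lt h w.
  have [|N _ hN] := h ((w.+1)%:R^-1)%R; first by rewrite invr_gt0 ltr0n.
  exists N => n Nn; have n0 : 0 < n by lia.
  have := hN n (ltnW Nn); rewrite /= ger0_norm ?mulr_ge0 ?invr_ge0 ?ler0n//.
  rewrite mulrC ltr_pdivrMr ?ltr0n// mulrC ltr_pdivlMr ?ltr0n// -natrM ltr_nat.
  lia.
move=> h; apply/cvgr0Pnorm_lt => e e0.
(* As [w] exceeds [1/e], a count [v] with [w v < n] satisfies [v / n < e]. *)
pose w := (Num.truncn (e^-1)%R).+1.
have we : (e^-1 < w%:R)%R by exact: truncnS_gt.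
have [N hN] := h w; exists N.+1 => // n /= Nn.
have n0 : 0 < n by lia.
rewrite ger0_norm ?mulr_ge0 ?invr_ge0 ?ler0n//.
rewrite mulrC ltr_pdivrMr ?ltr0n//.
have := hN n Nn; rewrite -(ltr_nat R) natrM => wv.
rewrite -(@ltr_pM2l _ (w%:R)%R) ?ltr0n//; apply: (lt_le_trans wv).
rewrite mulrA -[leLHS]mul1r ler_wpM2r ?ler0n//.
by rewrite mulrC -ler_pdivrMl// mulr1 ltW.
Qed.

Lemma saturation_translate A :
  \bigcup_(n in [set: int]) translate T n A = saturation T U A.
Proof.
apply/seteqP; split=> x.
  move=> [[k|k] _ kx]; last by exists k.+1; left.
  by exists k; right; move: kx; rewrite (translateP TK UK).
move=> [n [nx|nx]]; last by exists (Posz n) => //; rewrite (translateP TK UK).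
case: n nx => [|n] nx; last by exists (Negz n).
by exists (Posz 0) => //; rewrite (translateP TK UK).
Qed.

Lemma null_partE (R : realType) A :
  null_part R T A = saturation T U A `&` density0 A.
Proof.
rewrite /null_part saturation_translate; apply/seteqP.
by split=> x [sx dx]; split=> //; apply/(cvg_density0 R).
Qed.

Lemma density0T A x : density0 A x -> density0 A (T x).
Proof.
(* The factor 2 absorbs the shift: [2 w v < n + 1] and [n > 0] give [w v < n]. *)
move=> h w; have [N hN] := h (2 * w); exists N => n Nn.
by have := hN (1 + n) (leq_trans Nn (leq_addl _ _)); rewrite (visitsD T A x 1 n) /=; nia.
Qed.

Lemma density0U A x : density0 A x -> density0 A (U x).
Proof.
(* The extra [2 * w] pays for a possible visit at [U x]: [2 w v < n] and [2 w < n] give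
   [w (v + 1) < n]. *)
move=> h w; have [N hN] := h (2 * w); exists (N + 2 * w).+1 => -[//|n] Nn.
have := hN n; rewrite -(add1n n) (visitsD T A (U x) 1 n) /= UK.
have : visits T A (U x) 1 <= 1 by rewrite /visits /=; case: asbool.
by nia.
Qed.

Lemma sigma_density0 (M : set (set X)) A : invariant_sigma T U M -> M A ->
  M (density0 A).
Proof.
move=> hM MA; apply: (sigma_forall hM) => w; apply: (sigma_exists hM) => N.
apply: (sigma_forall hM) => n; apply: (sigma_imply hM) => _.
exact: (sigma_visits hM (fun v => w * v < n)).
Qed.

End NullPart.

Theorem theorem5p1 (R : realType) (X : Type) (B : set (set X)) (T : X -> X)
    (hX : standard_borel R B) (hT : borel_automorphism B T)
    (A : set X) (hA : B A) :
  has_set_generator B T (null_part R T A) 4.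
Proof.
have [[U TK UK] BT BTim] := hT.
have hB : invariant_sigma T U B.
  split=> //; first exact: standard_borel_sigma_algebra hX.
  move=> C /BTim; congr B; apply/seteqP; split=> x.
    by move=> [y Cy <-]; rewrite /preimage /mkset TK.
  by exists (U x).
have [C [BC Bmin]] := standard_borel_countably_generated hX.
rewrite (null_partE TK UK); set Y := _ `&` _.
have BY : B Y.
  by apply: (sigma_and hB); [exact: (sigma_saturation hB)|exact: (sigma_density0 hB)].
have YT x : Y x -> Y (T x).
  by move=> [sx dx]; split; [rewrite (saturationT TK)|exact: density0T].
have YU x : Y x -> Y (U x).
  by move=> [sx dx]; split; [rewrite -(saturationT TK) UK|exact: density0U].
(* [A] may leave [Y]; by invariance of [Y], orbits in [Y] visit [A] and its trace on [Y] at the same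
   times. *)
have AYY : A `&` Y `<=` Y by move=> x [].
have YA : Y `<=` saturation T U (A `&` Y).
  move=> x Yx; have [[n [An|An]] _] := Yx; exists n; [left|right]; split=> //.
    exact: (iter_closed YT).
  exact: (iter_closed YU).
have d0 w x : Y x -> exists N, forall n, N < n -> w * visits T (A `&` Y) x n < n.
  move=> Yx; have [_ /(_ w)[N hN]] := Yx; exists N => n /hN.
  rewrite (@eq_visits _ _ (A `&` Y) A)// => i _; split=> [[]|] // ?.
  by split=> //; exact: iter_closed.
have BA : B (A `&` Y) by exact: (sigma_and hB).
(* Thinning provides sparse points in both time directions, as the coding requires. *)
apply: (@has_set_generator4 _ T U B C TK UK hB BC Bmin Y (thinning T U Y (A `&` Y))) => //.
- exact: (sigma_thinning hB).
- exact: thinningY.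
- exact: saturation_thinning.
- by move=> w x; exact: thinning_forward.
- by move=> w x; exact: thinning_backward.
Qed.
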